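(* Let $N\ge1$, $p>2$, and $\delta\ge\max\{1,\frac{(p-1)^2}{4}\}$. Set $$l=\frac{2\delta}{p-1}-\frac{p-1}{2},\qquad k=\frac{\delta+p-1+2l}{\delta+p-1},$$ and for $R>0$ let $Q_R=\|w\|^k_{L^k(B_{2R}(0))}=\int_{B_{2R}(0)}w(x)^k\,dx$. Let $w\in C^1(\mathbb{R}^N)$ be a positive function with $w(x)>C$ for all $x$, for some constant $C>0$, and suppose $Q_R=\mathcal{O}(R^\tau)$ (as $R\to\infty$) for some $0<\tau<pk$. Then for every $0<\zeta<1$ there is no positive stable weak solution $u\in C^{1,\zeta}_{loc}(\mathbb{R}^N)$ of $$-\operatorname{div}\big(w(x)|\nabla u|^{p-2}\nabla u\big)=-u^{-\delta}\quad\text{in }\mathbb{R}^N.$$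
   Context: A function $u\in C^{1,\zeta}_{loc}(\mathbb{R}^N)$ is a weak solution of $-\operatorname{div}(w|\nabla u|^{p-2}\nabla u)=f(u)$ in $\mathbb{R}^N$ if $\int_{\mathbb{R}^N} w|\nabla u|^{p-2}\nabla u\cdot\nabla\varphi\,dx-\int_{\mathbb{R}^N} f(u)\varphi\,dx=0$ for all $\varphi\in C^1_c(\mathbb{R}^N)$. Such a weak solution is stable if for all $\varphi\in C^1_c(\mathbb{R}^N)$, $$\int_{\mathbb{R}^N} w|\nabla u|^{p-2}|\nabla\varphi|^2dx+(p-2)\int_{\mathbb{R}^N} w|\nabla u|^{p-4}(\nabla u\cdot\nabla\varphi)^2dx-\int_{\mathbb{R}^N} f'(u)\varphi^2dx\ge 0.$$ Here $f(u)=-u^{-\delta}$ for $u>0$, so $f'(u)=\delta u^{-\delta-1}$. $B_r(0)$ is the open ball of radius $r$ centered at the origin. *)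

(* Defs.v *)
From HB Require Import structures.
From mathcomp Require Import all_boot all_order all_algebra.
From mathcomp Require Import all_classical all_reals all_analysis.
Set Implicit Arguments. Unset Strict Implicit. Unset Printing Implicit Defensive.
Import Order.TTheory GRing.Theory Num.Theory.
Import numFieldNormedType.Exports.
Local Open Scope classical_set_scope.
Local Open Scope ring_scope.

Section Defs.
Variable R : realType.

Definition edot (N : nat) (a b : 'rV[R]_N) : R := \sum_(i < N) a 0 i * b 0 i.
Definition enorm (N : nat) (a : 'rV[R]_N) : R := Num.sqrt (edot a a).

Definition eball0 (N : nat) (r : R) : set 'rV[R]_N := [set x | enorm x < r].

Definition grad (N : nat) (u : 'rV[R]_N -> R) (x : 'rV[R]_N) : 'rV[R]_N :=
  \row_(i < N) ('D_(delta_mx 0 i) u x).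

Definition C1 (N : nat) (u : 'rV[R]_N -> R) : Prop :=
  (forall x, differentiable u x) /\ continuous (grad u).

Definition C1zeta_loc (N : nat) (zeta : R) (u : 'rV[R]_N -> R) : Prop :=
  C1 u /\
  forall r : R, 0 < r -> exists L : R, forall x y : 'rV[R]_N,
    enorm x < r -> enorm y < r ->
    enorm (grad u x - grad u y) <= L * powR (enorm (x - y)) zeta.

Definition C1c (N : nat) (phi : 'rV[R]_N -> R) : Prop :=
  C1 phi /\ exists r : R, forall x, r < enorm x -> phi x = 0.

Definition vcons (n : nat) (x : R) (y : 'rV[R]_n) : 'rV[R]_(1 + n) :=
  row_mx (const_mx x) y.

(* Lebesgue integral over R^n, computed as an iterated Lebesgue integral
   (real-valued version, for integrable integrands) *)
Fixpoint iintR (n : nat) : ('rV[R]_n -> R) -> R :=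
  match n with
  | 0 => fun f => f 0
  | n'.+1 => fun f =>
      Rintegral (@lebesgue_measure R) setT (fun x => iintR (fun y => f (vcons x y)))
  end.

(* extended-real version (for nonnegative integrands) *)
Fixpoint iintE (n : nat) : ('rV[R]_n -> \bar R) -> \bar R :=
  match n with
  | 0 => fun f => f 0
  | n'.+1 => fun f =>
      (\int[@lebesgue_measure R]_(x in setT) iintE (fun y => f (vcons x y)))%E
  end.

Definition weak_solution (N : nat) (p delta : R) (w u : 'rV[R]_N -> R) : Prop :=
  forall phi, C1c phi ->
    iintR (fun x => w x * powR (enorm (grad u x)) (p - 2) * edot (grad u x) (grad phi x))
    - iintR (fun x => - powR (u x) (- delta) * phi x) = 0.

(* stability, with f'(u) = delta u^{-delta-1} *)
Definition stable (N : nat) (p delta : R) (w u : 'rV[R]_N -> R) : Prop :=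
  forall phi, C1c phi ->
    iintR (fun x => w x * powR (enorm (grad u x)) (p - 2) * (enorm (grad phi x)) ^+ 2)
    + (p - 2) * iintR (fun x => w x * powR (enorm (grad u x)) (p - 4)
                                   * (edot (grad u x) (grad phi x)) ^+ 2)
    - iintR (fun x => delta * powR (u x) (- delta - 1) * (phi x) ^+ 2) >= 0.

Definition ell (p delta : R) : R := 2 * delta / (p - 1) - (p - 1) / 2.
Definition kexp (p delta : R) : R :=
  (delta + p - 1 + 2 * ell p delta) / (delta + p - 1).

Definition QR (N : nat) (p delta : R) (w : 'rV[R]_N -> R) (r : R) : \bar R :=
  iintE (fun x => if enorm x < 2 * r then (powR (w x) (kexp p delta))%:E else 0%E).

End Defs.

(* Main.v *)
(* Test the stability inequality with u^(-b) X^m and the equation with u^(-a) X^(2m),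
   where X = max(0, 1 - |x|^2/r^2), a = 4 delta/(p-1) and b = (a - 1)/2. Since
   (p-1) b^2 < delta a, some lam < delta makes the coefficients of
   w |grad u|^p u^(-2b-2) X^(2m) and u^(-delta-a) X^(2m) in
   (stability) + lam (equation) both negative. The error terms are then dominated
   pointwise, which leaves
     c \int u^(-delta-a) X^(2m) <= C r^(-pk) \int_{|x| < r} w^k = O(r^(tau - pk)),
   whereas the left-hand side is positive and nondecreasing in r. *)
Require Import Defs.
From HB Require Import structures.
From mathcomp Require Import all_boot all_order all_algebra.
From mathcomp Require Import all_classical all_reals all_analysis.
From mathcomp Require Import ring lra.
Import Order.TTheory GRing.Theory Num.Theory.
Import numFieldNormedType.Exports.
Local Open Scope classical_set_scope.
Local Open Scope ring_scope.

(** * Iterated integrals of continuous compactly supported functions *)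

(** Squaring u^(-b) against u^(-delta-1) and pairing u^(-a) with u^(-delta) produce the same power
    exactly when a = 2b + 1, which is why the two relations can be added. The value b = l + (p-2)/2
    is the one for which, once the gradient is absorbed, the error is r^(-p) w u^(-2l) up to a power
    of X. With E = u^(-(delta+p-1)) and theta = 2l/(delta+p-1) this error carries E^theta, the good
    term is E^(1+theta), and k = 1 + theta; Young's inequality then leaves exactly r^(-pk) w^k. The
    obstacle is formal: [iintR] is an iterated integral with default values, so neither linearity
    nor monotonicity holds for arbitrary integrands. Both are proved for continuous compactly
    supported functions, through an induction on the dimension, and every estimate is made
    pointwise, before integrating. A single comparison then leads to the extended integral [iintE]
    inside [QR]. *)

Lemma cts_comp (T U V : topologicalType) (f : T -> U) (g : U -> V) :
  continuous f -> continuous g -> continuous (fun x => g (f x)).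
Proof. by move=> cf cg x; apply: continuous_comp; [exact: cf|exact: cg]. Qed.

Section Continuity.
Variables (R : realType) (T : topologicalType).
Implicit Types f g : T -> R.

Lemma cts_cst (c : R) : continuous (fun _ : T => c).
Proof. by move=> x; exact: cvg_cst. Qed.

Lemma ctsD f g : continuous f -> continuous g -> continuous (fun x => f x + g x).
Proof. by move=> cf cg x; apply: cvgD; [exact: cf|exact: cg]. Qed.

Lemma ctsM f g : continuous f -> continuous g -> continuous (fun x => f x * g x).
Proof. by move=> cf cg x; apply: cvgM; [exact: cf|exact: cg]. Qed.

Lemma ctsN f : continuous f -> continuous (fun x => - f x).
Proof. by move=> cf x; apply: cvgN; exact: cf. Qed.

Lemma ctsB f g : continuous f -> continuous g -> continuous (fun x => f x - g x).
Proof. by move=> cf cg; apply: ctsD => //; exact: ctsN. Qed.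

Lemma cts_norm f : continuous f -> continuous (fun x => `|f x|).
Proof. by move=> cf x; apply: cvg_norm; exact: cf. Qed.

End Continuity.

Section Integral.
Variable R : realType.
Local Notation mu := (@lebesgue_measure R).

(** The support is measured in the sup norm, which dominates both components of [vcons x y]; slices
    therefore keep the same radius r, and slices at [|x| > r] vanish. *)
Definition csupp (n : nat) (r : R) (f : 'rV[R]_n -> R) : Prop :=
  continuous f /\ forall x, r < `|x| -> f x = 0.

Lemma norm_rVE n (x : 'rV[R]_n) :
  `|x| = \big[Order.max/0]_(k : 'I_1 * 'I_n) `|x k.1 k.2|.
Proof. exact: mx_normrE. Qed.

Lemma ler_coord_norm n (x : 'rV[R]_n) i : `|x 0 i| <= `|x|.
Proof.
rewrite norm_rVE.
exact: (le_bigmax (0 : R) (fun k : 'I_1 * 'I_n => `|x k.1 k.2|) (0, i)).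
Qed.

Lemma norm_rV_le n (x : 'rV[R]_n) r :
  0 <= r -> (forall i, `|x 0 i| <= r) -> `|x| <= r.
Proof.
move=> r0 xr; rewrite norm_rVE; apply: bigmax_le => // -[i j] _ /=.
by rewrite ord1.
Qed.

Lemma vcons_l n (x : R) (y : 'rV[R]_n) : vcons x y 0 (lshift n 0) = x.
Proof. by rewrite row_mxEl mxE. Qed.

Lemma vcons_r n (x : R) (y : 'rV[R]_n) i : vcons x y 0 (rshift 1 i) = y 0 i.
Proof. by rewrite row_mxEr. Qed.

Lemma vcons_norm_l n (x : R) (y : 'rV[R]_n) : `|x| <= `|vcons x y|.
Proof. by rewrite -[X in `|X| <= _](vcons_l _ x y); exact: ler_coord_norm. Qed.

Lemma vcons_norm_r n (x : R) (y : 'rV[R]_n) : `|y| <= `|vcons x y|.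
Proof.
by apply: norm_rV_le => // i; rewrite -(vcons_r _ x y); exact: ler_coord_norm.
Qed.

Lemma vcons_sub n (x x' : R) (y y' : 'rV[R]_n) :
  vcons x y - vcons x' y' = vcons (x - x') (y - y').
Proof.
by rewrite /vcons opp_row_mx add_row_mx; congr row_mx; apply/rowP => i; rewrite !mxE.
Qed.

Lemma vcons_norm_le n (x : R) (y : 'rV[R]_n) r :
  `|x| <= r -> `|y| <= r -> `|vcons x y| <= r.
Proof.
move=> xr yr; apply: norm_rV_le => [|i]; first exact: le_trans (normr_ge0 x) xr.
case: (split_ordP i) => j ->; first by rewrite (ord1 j) vcons_l.
by rewrite vcons_r; apply: le_trans yr; exact: ler_coord_norm.
Qed.

Lemma cts_vcons n (T : topologicalType) (f : T -> R) (g : T -> 'rV[R]_n) :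
  continuous f -> continuous g -> continuous (fun t => vcons (f t) (g t)).
Proof.
move=> cf cg t0.
have /cvgrPdist_le fa := cf t0; have /cvgrPdist_le gb := cg t0.
apply/cvgrPdist_le => e e0; near=> t.
by rewrite vcons_sub vcons_norm_le//; near: t; [exact: fa|exact: gb].
Unshelve. all: by end_near. Qed.

Lemma csupp_vcons n r (f : 'rV[R]_(n.+1) -> R) x :
  csupp _ r f -> csupp n r (fun y => f (vcons x y)).
Proof.
move=> [cf f0]; split.
  move=> y; apply: continuous_comp; last exact: cf.
  by apply: cts_vcons; [exact: cts_cst|move=> z; exact: cvg_id].
by move=> y ry; apply: f0; apply: lt_le_trans ry (vcons_norm_r _ _ _).
Qed.

Lemma csuppZD n r (f g : 'rV[R]_n -> R) a :
  csupp n r f -> csupp n r g -> csupp n r (fun x => a * f x + g x).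
Proof.
move=> [cf f0] [cg g0]; split; last by move=> x rx; rewrite f0// g0// mulr0 addr0.
by apply: ctsD => //; apply: ctsM => //; exact: cts_cst.
Qed.

Lemma csupp_le n r r' (f : 'rV[R]_n -> R) : r <= r' -> csupp n r f -> csupp n r' f.
Proof. by move=> rr [cf f0]; split=> // x xr; apply: f0; apply: le_lt_trans xr. Qed.

Lemma compact_ball_rV n (r : R) : compact [set y : 'rV[R]_n | `|y| <= r].
Proof.
apply: bounded_closed_compact.
  by exists r; split; rewrite ?num_real// => M rM x /= /le_trans; apply; apply: ltW.
have cn : continuous (fun x : 'rV[R]_n => `|x|) by exact: norm_continuous.
by have := @closed_comp _ _ _ _ (fun x _ => cn x) (@closed_le R r).
Qed.

Lemma integrable_csupp1 (F : R -> R) (r : R) :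
  continuous F -> (forall x, r < `|x| -> F x = 0) ->
  mu.-integrable setT (EFin \o F).
Proof.
move=> cF F0.
have -> : EFin \o F = (EFin \o F) \_ `[-r, r]%classic.
  apply/funext => x; rewrite patchE; case: ifPn => //.
  rewrite notin_setE /= in_itv/= -ler_norml => /negP; rewrite -ltNge => /F0 /=.
  by move->.
rewrite -integrable_mkcond; last exact: measurable_itv.
apply: continuous_compact_integrable; first exact: segment_compact.
exact: continuous_subspaceT.
Qed.

Lemma Rintegral_csupp1_le (F : R -> R) (r M : R) :
  0 <= r -> continuous F -> (forall x, r < `|x| -> F x = 0) ->
  (forall x, `|F x| <= M) -> `|Rintegral mu setT F| <= M * (2 * r).
Proof.
move=> r0 cF F0 FM; have iF := integrable_csupp1 F r cF F0.
have iFr : mu.-integrable `[-r, r]%classic (EFin \o F).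
  by apply: integrableS iF => //; exact: measurable_itv.
have -> : Rintegral mu setT F = Rintegral mu `[-r, r]%classic F.
  rewrite [RHS]Rintegral_mkcond; apply: eq_Rintegral => x _.
  rewrite patchE; case: ifPn => //.
  by rewrite notin_setE /= in_itv/= -ler_norml => /negP; rewrite -ltNge => /F0.
apply: (le_trans (le_normr_Rintegral _ iFr)); first exact: measurable_itv.
have -> : M * (2 * r) = Rintegral mu `[-r, r]%classic (cst M).
  rewrite Rintegral_cst; last exact: measurable_itv.
  congr (_ * _); have := lebesgue_measure_itv `[-r, r].
  rewrite /= lte_fin => E; rewrite [X in fine X]E.
  by case: ltP => /= ?; lra.
apply: le_Rintegral => //.
- apply: continuous_compact_integrable; first exact: segment_compact.
  by apply: continuous_subspaceT; exact: cts_norm.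
- apply: continuous_compact_integrable; first exact: segment_compact.
  by apply: continuous_subspaceT; exact: cts_cst.
Qed.

Lemma iintRS n (f : 'rV[R]_n.+1 -> R) :
  iintR f = Rintegral mu setT (fun x => iintR (fun y => f (vcons x y))).
Proof. by []. Qed.

Lemma iintR0 n : iintR (fun _ : 'rV[R]_n => 0) = 0.
Proof.
elim: n => [//|n IH]; rewrite iintRS.
under eq_Rintegral do rewrite IH.
by rewrite Rintegral_cst// mul0r.
Qed.

Lemma iintR_vcons_out n r (f : 'rV[R]_n.+1 -> R) x :
  csupp n.+1 r f -> r < `|x| -> iintR (fun y => f (vcons x y)) = 0.
Proof.
move=> [_ f0] rx; rewrite -(iintR0 n); congr iintR; apply/funext => y.
by apply: f0; apply: lt_le_trans rx (vcons_norm_l _ _ _).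
Qed.

(** Linearity and the volume bound are stated per dimension because they go through one induction:
    both in dimension n give continuity of slice integrals ([cts]), hence their integrability, hence
    both in dimension n+1. *)
Let lin n := forall (r : R) (f g : 'rV[R]_n -> R) (a : R), 0 <= r ->
  csupp n r f -> csupp n r g ->
  iintR (fun x => a * f x + g x) = a * iintR f + iintR g.

Let bnd n := forall (r M : R) (f : 'rV[R]_n -> R), 0 <= r -> csupp n r f ->
  (forall x, `|f x| <= M) -> `|iintR f| <= M * (2 * r) ^+ n.

(** Compactness of the ball (a tube argument through [near_covering]) makes the slices at x converge
    uniformly to the slice at x0; linearity turns the difference of integrals into one integral,
    which the volume bound controls. *)
Let cts n : lin n -> bnd n -> forall r (f : 'rV[R]_n.+1 -> R), 0 <= r ->
  csupp n.+1 r f -> continuous (fun x => iintR (fun y => f (vcons x y))).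
Proof.
move=> lin_n bnd_n r f r0 sf x0; apply/cvgrPdist_le => e e0.
(* The summand 1 keeps the denominator positive even if the volume (2r)^n is zero. *)
set d := e / (1 + (2 * r) ^+ n).
have dn : 0 <= (2 * r) ^+ n by rewrite exprn_ge0// mulr_ge0.
have d0 : 0 < d by rewrite divr_gt0// ltr_pwDl.
have : \forall x \near x0,
    [set y : 'rV[R]_n | `|y| <= r] `<=` (fun y => `|f (vcons x0 y) - f (vcons x y)| <= d).
  have nc : near_covering [set y : 'rV[R]_n | `|y| <= r].
    by apply/compact_near_coveringP; exact: compact_ball_rV.
  apply: (nc _ (nbhs x0) (fun x y => `|f (vcons x0 y) - f (vcons x y)| <= d)) => y _.
  have cF : continuous (fun z : 'rV[R]_n * R =>
      `|f (vcons x0 z.1) - f (vcons z.2 z.1)|).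
    have cv (h : 'rV[R]_n * R -> R) : continuous h ->
        continuous (fun z => f (vcons (h z) z.1)).
      move=> ch; apply: cts_comp (sf.1); apply: cts_vcons => // z.
      exact: cvg_fst.
    apply: cts_norm; apply: ctsB; apply: cv; first exact: cts_cst.
    by move=> z; exact: cvg_snd.
  have /cvgrPdist_lt/(_ d d0) := cF (y, x0).
  apply: filterS => -[y' x'] /=.
  by rewrite subrr normr0 sub0r normrN normr_id => /ltW.
apply: filterS => x H.
have -> : iintR (fun y => f (vcons x0 y)) - iintR (fun y => f (vcons x y)) =
    iintR (fun y => -1 * f (vcons x y) + f (vcons x0 y)).
  by rewrite (lin_n r)//; [rewrite mulN1r addrC|exact: csupp_vcons|exact: csupp_vcons].
apply: (@le_trans _ _ (d * (2 * r) ^+ n)).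
  apply: bnd_n => //; first by apply: csuppZD; exact: csupp_vcons.
  move=> y; rewrite mulN1r addrC; have [/H//|yr] := leP `|y| r.
  case: sf => _ f0; rewrite !f0 ?subr0 ?normr0 ?(ltW d0)//.
    by apply: lt_le_trans yr (vcons_norm_r _ _ _).
  by apply: lt_le_trans yr (vcons_norm_r _ _ _).
rewrite /d mulrAC ler_pdivrMr ?ltr_pwDl// ler_wpM2l ?(ltW e0)//.
by rewrite lerDr.
Qed.

Let lin_bnd n : lin n /\ bnd n.
Proof.
elim: n => [|n [lin_n bnd_n]].
  by split=> [r f g a _ _ _ //|r M f _ _ fM]; rewrite expr0 mulr1; exact: fM.
have cts_n := cts n lin_n bnd_n.
split=> [r f g a r0 sf sg|r M f r0 sf fM].
  rewrite !iintRS -RintegralZl//; last first.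
    apply: (integrable_csupp1 _ r); first exact: (cts_n r).
    by move=> x; exact: iintR_vcons_out.
  rewrite -RintegralD//.
  - apply: eq_Rintegral => x _; apply: (lin_n r) => //; exact: csupp_vcons.
  - apply: (integrable_csupp1 _ r).
      by apply: ctsM; [exact: cts_cst|exact: (cts_n r)].
    by move=> x /(iintR_vcons_out _ _ _ _ sf) ->; rewrite mulr0.
  - apply: (integrable_csupp1 _ r); first exact: (cts_n r).
    by move=> x; exact: iintR_vcons_out.
rewrite iintRS exprSr mulrA; apply: Rintegral_csupp1_le => //.
- exact: (cts_n r).
- by move=> x; exact: iintR_vcons_out.
- by move=> x; apply: bnd_n => //; exact: csupp_vcons.
Qed.

Definition has_csupp n (f : 'rV[R]_n -> R) : Prop :=
  continuous f /\ exists r, forall x, r < `|x| -> f x = 0.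

Lemma has_csuppP n (f : 'rV[R]_n -> R) :
  has_csupp n f -> exists2 r, 0 <= r & forall r', r <= r' -> csupp n r' f.
Proof.
move=> [cf [r f0]]; exists (Num.max r 0); first by rewrite le_max lexx orbT.
by move=> r'; rewrite ge_max => /andP[rr' _]; apply: csupp_le rr' _.
Qed.

Lemma iintR_lin n (f g : 'rV[R]_n -> R) a : has_csupp n f -> has_csupp n g ->
  iintR (fun x => a * f x + g x) = a * iintR f + iintR g.
Proof.
move=> /has_csuppP[r r0 sf] /has_csuppP[s s0 sg].
apply: ((lin_bnd n).1 (r + s)); first exact: addr_ge0.
  by apply: sf; rewrite lerDl.
by apply: sg; rewrite lerDr.
Qed.

Lemma iintR_ge0 n (f : 'rV[R]_n -> R) : (forall x, 0 <= f x) -> 0 <= iintR f.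
Proof.
elim: n f => [f f0|n IH f f0]; first exact: f0.
by rewrite iintRS; apply: Rintegral_ge0 => x _; exact: IH.
Qed.

Lemma has_csupp_lin n (f g : 'rV[R]_n -> R) a : has_csupp n f -> has_csupp n g ->
  has_csupp n (fun x => a * f x + g x).
Proof.
move=> /has_csuppP[r r0 sf] /has_csuppP[s s0 sg].
have [] : csupp n (r + s) (fun x => a * f x + g x).
  by apply: csuppZD; [apply: sf; rewrite lerDl|apply: sg; rewrite lerDr].
by split=> //; exists (r + s).
Qed.

Lemma iintR_le n (f g : 'rV[R]_n -> R) : has_csupp n f -> has_csupp n g ->
  (forall x, f x <= g x) -> iintR f <= iintR g.
Proof.
move=> sf sg fg; rewrite -subr_ge0 addrC -mulN1r -iintR_lin//.
by apply: iintR_ge0 => x; rewrite mulN1r addrC subr_ge0.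
Qed.

Lemma slice_csupp n r (f : 'rV[R]_n.+1 -> R) (F := fun x => iintR (fun y => f (vcons x y))) :
  0 <= r -> csupp n.+1 r f -> continuous F /\ mu.-integrable setT (EFin \o F).
Proof.
move=> r0 sf; have [ln bn] := lin_bnd n.
have cF : continuous F by exact: (cts n ln bn r).
split=> //; apply: (integrable_csupp1 _ r) => // x.
exact: iintR_vcons_out.
Qed.

Lemma vcons0 n : @vcons R n 0 0 = 0.
Proof. by rewrite /vcons raddf0 row_mx0. Qed.

(** The origin is the base point because its slice is again based at the origin, so the induction
    gives [0 < F 0]; continuity then keeps F above [F 0 / 2] on a short interval. *)
Lemma iintR_gt0 n (f : 'rV[R]_n -> R) : has_csupp n f ->
  (forall x, 0 <= f x) -> 0 < f 0 -> 0 < iintR f.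
Proof.
move=> /has_csuppP[r r0 /(_ r (lexx r))].
elim: n f => [f _ _ //|n IH f sf f0 f00]; rewrite iintRS.
have [cF iF] := slice_csupp _ _ _ r0 sf.
set F := fun x => _ in cF iF *.
have F0 : 0 < F 0.
  by apply: IH; [exact: csupp_vcons|move=> y; exact: f0|rewrite vcons0].
have Fge0 x : 0 <= F x by apply: iintR_ge0.
have /cvgrPdist_lt/(_ _ (divr_gt0 F0 (ltr0n _ 2))) := cF 0.
case=> d /= d0 dF.
have cst_i : mu.-integrable `[0, d / 2]%classic (EFin \o cst (F 0 / 2)).
  apply: continuous_compact_integrable; first exact: segment_compact.
  by apply: continuous_subspaceT; exact: cts_cst.
apply: (@lt_le_trans _ _ (Rintegral mu `[0, d / 2]%classic (cst (F 0 / 2)))).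
  rewrite Rintegral_cst; last exact: measurable_itv.
  have := lebesgue_measure_itv `[0, d / 2].
  rewrite /= lte_fin divr_gt0// => E; rewrite [X in fine X]E/= subr0.
  by rewrite mulr_gt0// divr_gt0.
rewrite Rintegral_mkcond; apply: le_Rintegral => //.
  rewrite -restrict_EFin -integrable_mkcond//; exact: measurable_itv.
move=> x _; rewrite patchE; case: ifPn => [|_]; last exact: Fge0.
rewrite inE/= in_itv/= => /andP[x0 xd].
have /dF : ball_ Num.norm 0 d x.
  by rewrite /= sub0r normrN ger0_norm//; apply: le_lt_trans xd _; lra.
rewrite /= ltr_norml => /andP[_ FF]; rewrite -[leRHS]/(F x).
by move: (F 0) (F x) FF => a b; lra.
Qed.

(** The integral of a nonnegative function is a supremum over the simple functions below it, and a
    larger function admits more of them. This form serves for the slices of [iintE], whose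
    measurability is never established. *)
Lemma le_integral_ge0 (f g : R -> \bar R) : (forall x, 0 <= f x)%E ->
  (forall x, f x <= g x)%E ->
  (integral mu setT f <= integral mu setT g)%E.
Proof.
move=> f0 fg; rewrite !ge0_integralTE// => [|x]; last exact: le_trans (fg x).
apply: le_ereal_sup => _ [h hf <-]; exists h => // x.
by apply: le_trans (fg x); exact: hf.
Qed.

(** The bridge between the two integrals: slice integrals of f are integrable, so passing to real
    values loses nothing, while h may be discontinuous, as the truncated w^k in [QR] is. *)
Lemma iintR_le_iintE n (f : 'rV[R]_n -> R) (h : 'rV[R]_n -> \bar R) :
  has_csupp n f -> (forall x, 0 <= f x) -> (forall x, (f x)%:E <= h x)%E ->
  ((iintR f)%:E <= iintE h)%E.
Proof.
move=> /has_csuppP[r r0 /(_ r (lexx r))].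
elim: n f h => [f h _ _ fh|n IH f h sf f0 fh]; first exact: fh.
have [cF iF] := slice_csupp _ _ _ r0 sf.
rewrite iintRS /Rintegral fineK; last exact: integrable_fin_num.
apply: le_integral_ge0 => x; first by rewrite lee_fin iintR_ge0.
by apply: IH; [exact: csupp_vcons|move=> y; exact: f0|move=> y; exact: fh].
Qed.

End Integral.

(** * Euclidean geometry and gradients *)

Section Calculus.
Variable R : realType.

Lemma ctsZ (T : topologicalType) (V : normedModType R) (a : T -> R) (v : T -> V) :
  continuous a -> continuous v -> continuous (fun x => a x *: v x).
Proof. by move=> ca cv x; apply: cvgZ; [exact: ca|exact: cv]. Qed.

Lemma ctsDV (T : topologicalType) (V : normedModType R) (a v : T -> V) :
  continuous a -> continuous v -> continuous (fun x => a x + v x).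
Proof. by move=> ca cv x; apply: cvgD; [exact: ca|exact: cv]. Qed.

Lemma cts_sqrt (T : topologicalType) (f : T -> R) :
  continuous f -> continuous (fun x => Num.sqrt (f x)).
Proof. by move=> cf; apply: cts_comp cf _; exact: sqrt_continuous. Qed.

Lemma ctsX (T : topologicalType) (f : T -> R) k :
  continuous f -> continuous (fun x => f x ^+ k).
Proof.
move=> cf; elim: k => [|k IH]; first by under eq_fun do rewrite expr0; exact: cts_cst.
by under eq_fun do rewrite exprS; exact: ctsM.
Qed.

Lemma cts_max0 (T : topologicalType) (f : T -> R) :
  continuous f -> continuous (fun x => Num.max 0 (f x)).
Proof.
move=> cf x; apply: (@continuous_max R T (fun=> 0) f x); last exact: cf.
exact: cvg_cst.
Qed.

Lemma cts_sum (T : topologicalType) n (f : 'I_n -> T -> R) :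
  (forall i, continuous (f i)) -> continuous (fun x => \sum_(i < n) f i x).
Proof.
elim: n f => [f _|n IH f cf].
  by under eq_fun do rewrite big_ord0; exact: cts_cst.
under eq_fun do rewrite big_ord_recl.
by apply: ctsD; [exact: cf|apply: IH => i; exact: cf].
Qed.

Lemma cts_coord (T : topologicalType) n (a : T -> 'rV[R]_n) i :
  continuous a -> continuous (fun x => a x 0 i).
Proof.
move=> ca; have cc := @coord_continuous R 1 n 0 i.
exact (cts_comp _ _ _ _ _ ca cc).
Qed.

Lemma cts_edot (T : topologicalType) n (a b : T -> 'rV[R]_n) :
  continuous a -> continuous b -> continuous (fun x => edot (a x) (b x)).
Proof. by move=> ca cb; apply: cts_sum => i; apply: ctsM; exact: cts_coord. Qed.

Lemma cts_enorm (T : topologicalType) n (a : T -> 'rV[R]_n) :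
  continuous a -> continuous (fun x => enorm (a x)).
Proof. by move=> ca; apply: cts_sqrt; exact: cts_edot. Qed.

Lemma cts_powR (T : topologicalType) (f : T -> R) s :
  (forall x, 0 < f x) -> continuous f -> continuous (fun x => powR (f x) s).
Proof.
move=> f0 cf x; apply: (@continuous_comp T R R f (fun t => powR t s) x); first exact: cf.
apply: differentiable_continuous; apply/derivable1_diffP.
by apply: derivable_powR; rewrite in_itv/= f0.
Qed.

Lemma powR_lt0cvg s (e : R) : 0 < s -> 0 < e -> forall t, 0 <= t ->
  t < powR e s^-1 -> powR t s < e.
Proof.
move=> s0 e0 t t0 te.
have -> : e = powR (powR e s^-1) s by rewrite -powRrM mulVf ?powRr1 ?ltW// gt_eqF.
by apply: gt0_ltr_powR => //; rewrite nnegrE// powR_ge0.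
Qed.

(** Where f vanishes, differentiability of the power is replaced by the explicit threshold e^(1/s).
    This is what makes |grad u|^(p-2) continuous at critical points of u. *)
Lemma cts_powR_ge0 (T : topologicalType) (f : T -> R) s :
  0 < s -> (forall x, 0 <= f x) -> continuous f -> continuous (fun x => powR (f x) s).
Proof.
move=> s0 f0 cf x; have [fx0|fx0] := eqVneq (f x) 0; last first.
  apply: (@continuous_comp T R R f (fun t => powR t s) x); first exact: cf.
  apply: differentiable_continuous; apply/derivable1_diffP.
  by apply: derivable_powR; rewrite in_itv/= andbT lt_def fx0 f0.
apply/cvgrPdist_lt => e e0; rewrite fx0 powR0 ?gt_eqF//.
have e1 : 0 < powR e s^-1 by exact: powR_gt0.
have /cvgrPdist_lt/(_ _ e1) := cf x.
apply: filterS => y; rewrite fx0 !sub0r !normrN ger0_norm// ger0_norm ?powR_ge0//.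
exact: powR_lt0cvg.
Qed.

Lemma edotC n (a b : 'rV[R]_n) : edot a b = edot b a.
Proof. by apply: eq_bigr => i _; rewrite mulrC. Qed.

Lemma edotDr n (a b c : 'rV[R]_n) : edot a (b + c) = edot a b + edot a c.
Proof. by rewrite -big_split; apply: eq_bigr => i _; rewrite mxE mulrDr. Qed.

Lemma edotZr n (a b : 'rV[R]_n) k : edot a (k *: b) = k * edot a b.
Proof. by rewrite mulr_sumr; apply: eq_bigr => i _; rewrite mxE mulrCA. Qed.

Lemma edotDl n (a b c : 'rV[R]_n) : edot (b + c) a = edot b a + edot c a.
Proof. by rewrite edotC edotDr !(edotC _ a). Qed.

Lemma edotZl n (a b : 'rV[R]_n) k : edot (k *: b) a = k * edot b a.
Proof. by rewrite edotC edotZr edotC. Qed.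

Lemma edot_ge0 n (a : 'rV[R]_n) : 0 <= edot a a.
Proof. by apply: sumr_ge0 => i _; rewrite -expr2 sqr_ge0. Qed.

Lemma enorm_ge0 n (a : 'rV[R]_n) : 0 <= enorm a.
Proof. exact: sqrtr_ge0. Qed.

Lemma enorm_sqr n (a : 'rV[R]_n) : enorm a ^+ 2 = edot a a.
Proof. by rewrite sqr_sqrtr// edot_ge0. Qed.

Lemma enorm_eq0 n (a : 'rV[R]_n) : enorm a = 0 -> a = 0.
Proof.
move=> /(congr1 (fun t => t ^+ 2)); rewrite enorm_sqr expr0n/= => /eqP.
rewrite psumr_eq0 => [/allP aE|i _]; last by rewrite -expr2 sqr_ge0.
apply/rowP => i; have := aE i (mem_index_enum _).
by rewrite mulf_eq0 orbb mxE => /eqP.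
Qed.

Lemma edot0l n (b : 'rV[R]_n) : edot 0 b = 0.
Proof. by rewrite /edot big1// => i _; rewrite mxE mul0r. Qed.

Lemma edot0r n (b : 'rV[R]_n) : edot b 0 = 0.
Proof. by rewrite edotC edot0l. Qed.

Lemma enorm0 n : enorm (0 : 'rV[R]_n) = 0.
Proof. by rewrite /enorm edot0l sqrtr0. Qed.

(** Expanding the squared norm of [enorm b *: a - enorm a *: b] gives 2|a||b|(|a||b| - a.b) >= 0;
    the division needs both norms nonzero, hence the two preliminary cases. *)
Lemma edot_CS n (a b : 'rV[R]_n) : edot a b <= enorm a * enorm b.
Proof.
have [a0|a0] := eqVneq (enorm a) 0; first by rewrite (enorm_eq0 _ _ a0) edot0l enorm0 mul0r.
have [b0|b0] := eqVneq (enorm b) 0; first by rewrite (enorm_eq0 _ _ b0) edot0r enorm0 mulr0.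
have A : 0 < enorm a by rewrite lt_def a0 enorm_ge0.
have B : 0 < enorm b by rewrite lt_def b0 enorm_ge0.
have := edot_ge0 _ (enorm b *: a - enorm a *: b).
rewrite -scaleN1r !(edotDr, edotDl, edotZr, edotZl) -!enorm_sqr (edotC _ b a).
move: (edot a b) (enorm a) (enorm b) A B => d x y x0 y0 H.
rewrite -(ler_pM2l (mulr_gt0 x0 y0)); move: H; nra.
Qed.

Lemma edot_CS_sqr n (a b : 'rV[R]_n) : edot a b ^+ 2 <= enorm a ^+ 2 * enorm b ^+ 2.
Proof.
have h1 := edot_CS _ a b.
have h2 : - edot a b <= enorm a * enorm b.
  have := edot_CS _ (-1 *: a) b; rewrite edotZl mulN1r.
  by rewrite {1}/enorm edotZl edotZr mulrA mulrNN mulr1 mul1r.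
rewrite -exprMn; move: (edot a b) (enorm a * enorm b) h1 h2 => d e; nra.
Qed.

Lemma norm_le_enorm n (x : 'rV[R]_n) : `|x| <= enorm x.
Proof.
apply: norm_rV_le => [|i]; first exact: enorm_ge0.
rewrite -(ler_pXn2r (ltn0Sn 1)) ?nnegrE ?enorm_ge0// enorm_sqr real_normK ?num_real//.
rewrite /edot (bigD1 i)//= expr2 lerDl; apply: sumr_ge0 => j _.
by rewrite -expr2 sqr_ge0.
Qed.

End Calculus.

(** * Gradients of products and compositions, and the quadratic bump *)

Section Gradient.
Variables (R : realType) (n : nat).
Implicit Types f g : 'rV[R]_n -> R.

Lemma grad_mul f g x : differentiable f x -> differentiable g x ->
  grad (fun y => f y * g y) x = f x *: grad g x + g x *: grad f x.
Proof.
move=> df dg; apply/rowP => i; rewrite !mxE.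
rewrite deriveE; last exact: differentiableM.
by rewrite (diffM df dg) !deriveE.
Qed.

Lemma differentiable_Rcomp f (g : R -> R) d x : differentiable f x ->
  is_derive (f x) 1 g d -> differentiable (fun y => g (f y)) x.
Proof.
move=> df [dg _]; apply: (differentiable_comp df).
exact/derivable1_diffP.
Qed.

Lemma grad_Rcomp f (g : R -> R) d x : differentiable f x ->
  is_derive (f x) 1 g d -> grad (fun y => g (f y)) x = d *: grad f x.
Proof.
move=> df dg; apply/rowP => i; rewrite !mxE.
rewrite deriveE; last exact: differentiable_Rcomp dg.
case: dg => dg <-; have dg' : differentiable g (f x) by exact/derivable1_diffP.
have -> : 'd (fun y => g (f y)) x = 'd g (f x) \o 'd f x :> (_ -> _).
  exact: (diff_comp df dg').
by rewrite /= deriv1E// derive1E -(deriveE _ df) [LHS]mulrC.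
Qed.

Lemma C1_cts f : C1 f -> continuous f.
Proof. by move=> [df _] x; exact: differentiable_continuous. Qed.

Lemma C1_mul f g : C1 f -> C1 g -> C1 (fun x => f x * g x).
Proof.
move=> Cf Cg; split=> [x|]; first by apply: differentiableM; [exact: Cf.1|exact: Cg.1].
rewrite (_ : grad _ = fun x => f x *: grad g x + g x *: grad f x).
  by apply: ctsDV; apply: ctsZ; [exact: C1_cts|exact: Cg.2|exact: C1_cts|exact: Cf.2].
by apply/funext => x; rewrite grad_mul//; [exact: Cf.1|exact: Cg.1].
Qed.

Lemma C1_Rcomp f (g g' : R -> R) : C1 f ->
  (forall x, is_derive (f x) 1 g (g' (f x))) ->
  continuous (fun x => g' (f x)) -> C1 (fun x => g (f x)).
Proof.
move=> Cf dg cg; split=> [x|].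
  exact: differentiable_Rcomp (Cf.1 x) (dg x).
rewrite (_ : grad _ = fun x => g' (f x) *: grad f x).
  by apply: ctsZ; [exact: cg|exact: Cf.2].
by apply/funext => x; rewrite (grad_Rcomp _ _ (g' (f x)))//; exact: Cf.1.
Qed.

(** A quadratic profile is smooth also at the origin and has a linear gradient; the only kink of the
    cutoff comes from the positive part, and powers of at least 2 remove it. *)
Definition quadbump (r : R) (x : 'rV[R]_n) : R := 1 - edot x x / r ^+ 2.

Lemma is_derive_coord (i : 'I_n) (x v : 'rV[R]_n) :
  is_derive x v (fun y : 'rV[R]_n => y 0 i) (v 0 i).
Proof.
have did : derivable (fun y : 'rV[R]_n => y) x v by exact: derivable_id.
apply: DeriveDef; first exact: ((derivable_mxP _ _ _).1 did).
by rewrite -[in RHS](derive_id x v) (derive_mx did) mxE.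
Qed.

Lemma edot_self_sumE :
  (fun y : 'rV[R]_n => edot y y) = \sum_(i < n) (fun y : 'rV[R]_n => y 0 i * y 0 i).
Proof. by rewrite fct_sumE. Qed.

Lemma differentiable_quadbump r x : differentiable (quadbump r) x.
Proof.
have dq : differentiable (fun y : 'rV[R]_n => edot y y) x.
  rewrite edot_self_sumE; apply: differentiable_sum => i.
  by apply: differentiableM; exact: differentiable_coord.
by apply: differentiableB => //; apply: differentiableM.
Qed.

Lemma grad_quadbump r x : grad (quadbump r) x = (- 2 / r ^+ 2) *: x.
Proof.
apply/rowP => i; rewrite !mxE.
have dq : is_derive x (delta_mx 0 i) (fun y : 'rV[R]_n => edot y y) (2 * x 0 i).
  rewrite edot_self_sumE.
  have dc j := is_derive_coord j x (delta_mx 0 i).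
  apply: is_derive_eq (is_derive_sum (fun j => is_deriveM (dc j) (dc j))) _.
  rewrite (bigD1 i)//= big1 => [|j ji]; rewrite !mxE/=.
    by rewrite eqxx /GRing.scale/= mulr1 addr0 mulr_natl.
  by rewrite (negbTE ji) scaler0 addr0.
have [_ E] := is_deriveB (is_derive_cst (1 : R) x (delta_mx 0 i)) (is_deriveM dq (is_derive_cst (r ^- 2) x (delta_mx 0 i))).
apply: etrans E _; rewrite scaler0 !add0r /GRing.scale/=; ring.
Qed.

Lemma C1_quadbump r : C1 (quadbump r).
Proof.
split=> [x|]; first exact: differentiable_quadbump.
rewrite (_ : grad _ = fun x => (- 2 / r ^+ 2) *: x).
  by apply: ctsZ; [exact: cts_cst|move=> x; exact: cvg_id].
by apply/funext => x; exact: grad_quadbump.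
Qed.

End Gradient.

(** * Differentiability of powers of the positive part *)

Section Pospart.
Variable R : realType.

Lemma is_derive_pos2 (t : R) :
  is_derive t 1 (fun s => Num.max 0 s ^+ 2) (2 * Num.max 0 t).
Proof.
have [t0|t0|t0] := ltgtP t 0.
- have E : \near t, (cst 0 : R -> R) t = (fun s => Num.max 0 s ^+ 2) t.
    near=> s; have s0 : s < 0 by near: s; exact: lt_nbhsl.
    by rewrite max_l ?ltW// expr0n.
  rewrite mulr0.
  by apply: (near_eq_is_derive E); exact: is_derive_cst.
- have E : \near t, (fun s : R => s ^+ 2) t = (fun s => Num.max 0 s ^+ 2) t.
    near=> s; have s0 : 0 < s by near: s; exact: lt_nbhsr.
    by rewrite max_r ?ltW.
  apply: (near_eq_is_derive E).
  apply: DeriveDef; first exact: exprn_derivable.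
  by rewrite exp_derive /GRing.scale/=; ring.
rewrite t0 mulr0.
(* At 0 the difference quotient is exactly [Num.max 0 h], which tends to 0. *)
have cv : (fun h : R => h^-1 *: (Num.max 0 (h *: (1 : R) + 0 : R) ^+ 2 - Num.max 0 (0 : R) ^+ 2)) @ 0^' --> (0 : R).
  have c : (fun h : R => Num.max 0 h) @ 0^' --> (0 : R).
    have cid : continuous (fun x : R => x) by move=> x; exact: cvg_id.
    have := cts_max0 _ _ _ cid 0.
    rewrite /= /continuous_at maxxx; apply: cvg_trans; apply: cvg_app; exact: nbhs_dnbhs.
  apply: cvg_trans c; apply: near_eq_cvg; near=> h.
  have h0 : h != 0 by near: h; exact: nbhs_dnbhs_neq.
  rewrite maxxx expr0n subr0 scaler1 addr0.
  have [h1|h1] := leP h 0; first by rewrite expr0n scaler0.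
  by rewrite expr2 scalerA mulVf// scale1r.
apply: DeriveDef; first by apply/cvg_ex; exists 0.
exact: (cvg_lim _ cv).
Unshelve. all: by end_near. Qed.

(** The factor split off is s and not [Num.max 0 s]: it is differentiable at 0, so the product rule
    applies there. *)
Lemma is_derive_posX k (t : R) :
  is_derive t 1 (fun s => Num.max 0 s ^+ k.+2) (k.+2%:R * Num.max 0 t ^+ k.+1).
Proof.
elim: k => [|k IH]; first exact: is_derive_pos2.
have -> : (fun s : R => Num.max 0 s ^+ k.+3) = (fun s => s * Num.max 0 s ^+ k.+2).
  by apply/funext => s; rewrite exprS; case: ltP => // s0; rewrite exprS !mul0r mulr0.
have [D1 D2] := @is_deriveM R R id (fun s => Num.max 0 s ^+ k.+2) t 1 _ _ (is_derive_id t 1) IH.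
apply: DeriveDef; first exact: D1.
apply: etrans D2 _; rewrite /GRing.scale/= mulr1.
have [t0|t0] := leP t 0; first by rewrite !exprS !mul0r !mulr0 addr0.
by rewrite -[in RHS]natr1 !exprS; ring.
Qed.

End Pospart.

(** * Pointwise inequalities *)

Section Pointwise.
Variable R : realType.

Lemma powR_add (x s t : R) : 0 < x -> powR x (s + t) = powR x s * powR x t.
Proof. by move=> x0; rewrite powRD// (gt_eqF x0) implybT. Qed.

(** Cauchy-Schwarz, the factor |U|^2 raising the exponent from p-4 to p-2. At U = 0 the factor
    [edot U V] vanishes, whatever value [powR 0 (p - 4)] has. *)
Lemma powR_edot_le n (p : R) (U V : 'rV[R]_n) :
  powR (enorm U) (p - 4) * edot U V ^+ 2 <= powR (enorm U) (p - 2) * enorm V ^+ 2.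
Proof.
have [U0|U0] := eqVneq (enorm U) 0.
  rewrite (enorm_eq0 _ _ _ U0) edot0l expr0n mulr0 mulr_ge0// ?powR_ge0//.
  exact: sqr_ge0.
have -> : powR (enorm U) (p - 2) = powR (enorm U) (p - 4) * enorm U ^+ 2.
  rewrite -powR_mulrn ?enorm_ge0// -powRD; last by rewrite U0 implybT.
  by congr powR; ring.
by rewrite -mulrA ler_wpM2l ?powR_ge0// edot_CS_sqr.
Qed.

(** V and E stand for the gradients of the two test functions, with Z = u^(-b-1) X^m, Y = m u^(-b)
    X^(m-1) and g the gradient of the bump. Everything reduces to a quadratic form in s and t; its
    factor p-1 is 1 + (p-2), the second part coming from [powR_edot_le]. *)
Lemma grad_energy_le n (p b a lam W Z Y : R) (U g : 'rV[R]_n) :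
  2 < p -> 0 <= b -> 0 <= lam -> 0 <= W -> 0 <= Z -> 0 <= Y ->
  let V := - b * Z *: U + Y *: g in
  let E := - a * Z ^+ 2 *: U + 2 * Z * Y *: g in
  let s := Z * enorm U in
  let t := Y * enorm g in
  is_true (W * powR (enorm U) (p - 2) * enorm V ^+ 2 +
    (p - 2) * (W * powR (enorm U) (p - 4) * edot U V ^+ 2) +
    lam * (W * powR (enorm U) (p - 2) * edot U E) <=
  W * powR (enorm U) (p - 2) *
    ((p - 1) * (b * s + t) ^+ 2 - lam * a * s ^+ 2 + 2 * lam * s * t)).
Proof.
move=> p2 b0 lam0 W0 Z0 Y0 V E s t.
have G0 := enorm_ge0 _ _ U; have g0 := enorm_ge0 _ _ g.
have UV := powR_edot_le _ p U V.
have cs1 := edot_CS _ _ U g.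
have cs2 := edot_CS _ _ (-1 *: U) g.
have cs : - (enorm U * enorm g) <= edot U g.
  rewrite lerNl; move: cs2; rewrite edotZl mulN1r.
  by rewrite {1}/enorm edotZl edotZr mulrA mulrNN mulr1 mul1r.
have VV : enorm V ^+ 2 <= (b * s + t) ^+ 2.
  rewrite enorm_sqr !(edotDr, edotDl, edotZr, edotZl) -!enorm_sqr (edotC _ _ g U).
  rewrite /s /t; move: (edot U g) (enorm U) (enorm g) G0 g0 cs => d x y x0 y0 cs.
  have : 0 <= b * Z * Y * (d + x * y) by rewrite !mulr_ge0// -lerBlDr sub0r.
  by move=> h; rewrite -subr_ge0; move: h; nra.
have UE : edot U E <= - a * s ^+ 2 + 2 * s * t.
  rewrite edotDr !edotZr -enorm_sqr /s /t.
  move: (edot U g) (enorm U) (enorm g) G0 g0 cs1 => d x y x0 y0 cs'.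
  have : 0 <= 2 * Z * Y * (x * y - d) by rewrite !mulr_ge0// subr_ge0.
  by move=> h; rewrite -subr_ge0; move: h; nra.
move: (powR_ge0 (enorm U) (p - 2)) UV VV UE.
move: (powR _ _) (powR _ _) (edot U V) (enorm V ^+ 2) (edot U E) => P' P d v e.
move=> P0 UV VV UE.
have h1 : W * P' * d ^+ 2 <= W * P * v by rewrite -!mulrA ler_wpM2l.
have h2 : W * P * v <= W * P * (b * s + t) ^+ 2 by rewrite ler_wpM2l// mulr_ge0.
have h3 : lam * (W * P * e) <= lam * (W * P * (- a * s ^+ 2 + 2 * s * t)).
  by rewrite ler_wpM2l// ler_wpM2l// mulr_ge0.
have h4 : (p - 2) * (W * P' * d ^+ 2) <= (p - 2) * (W * P * (b * s + t) ^+ 2).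
  by rewrite ler_wpM2l ?(le_trans h1 h2)// subr_ge0 ltW.
apply: le_trans (lerD (lerD h2 h4) h3) _.
rewrite le_eqVlt; apply/orP; left; apply/eqP; ring.
Qed.

(** This is (K s - B t)^2 / (2K) >= 0; half of K s^2 is kept for the later gradient estimate. *)
Lemma quad_absorb (B K s t : R) : 0 < K ->
  B * s * t - K * s ^+ 2 <= - (K / 2) * s ^+ 2 + B ^+ 2 / (2 * K) * t ^+ 2.
Proof.
move=> K0; have h := sqr_ge0 (K * s - B * t).
have : 0 <= (K * s - B * t) ^+ 2 / (2 * K) by rewrite divr_ge0// mulr_ge0// ltW.
have -> : (K * s - B * t) ^+ 2 / (2 * K) =
  K / 2 * s ^+ 2 - B * s * t + B ^+ 2 / (2 * K) * t ^+ 2.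
  by field; rewrite gt_eqF.
lra.
Qed.

(* A case split replacing Young's inequality with exponents p/(p-2) and p/2. *)
Lemma young_gradient (p e C m G v X rho b : R) :
  2 < p -> 0 < e -> 0 <= C -> 0 <= m -> 0 <= G -> 0 < v -> 0 < X -> 0 < rho ->
  powR G (p - 2) * (- e * (powR v (- b - 1) * powR X m * G) ^+ 2 +
    C * (m * powR v (- b) * powR X (m - 1) * rho) ^+ 2) <=
  C * m ^+ 2 * powR (C * m ^+ 2 / e) ((p - 2) / 2) *
    (powR rho p * powR v (p - 2 - 2 * b) * powR X (2 * m - p)).
Proof.
move=> p2 e0 C0 m0 G0 v0 X0 rho0.
set s := _ * G; set t := _ * rho.
have rhs0 : 0 <= C * m ^+ 2 * powR (C * m ^+ 2 / e) ((p - 2) / 2) *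
    (powR rho p * powR v (p - 2 - 2 * b) * powR X (2 * m - p)).
  by rewrite !mulr_ge0 ?powR_ge0// sqr_ge0.
have [st|st] := leP (C * t ^+ 2) (e * s ^+ 2).
  apply: le_trans rhs0; rewrite mulr_ge0_le0 ?powR_ge0//.
  by rewrite mulNr addrC subr_le0.
have CM0 : 0 <= C * m ^+ 2 / e by rewrite divr_ge0 ?mulr_ge0 ?sqr_ge0// ltW.
(* With the common factor Q one has s = Q G and t = m Q (v rho / X), so the remaining case e s^2 < C
   t^2 bounds G by a multiple of v rho / X, and hence the weight G^(p-2). *)
have GM : G ^+ 2 <= C * m ^+ 2 / e * (v * rho / X) ^+ 2.
  set Q := powR v (- b - 1) * powR X m.
  have Q0 : 0 < Q by rewrite mulr_gt0// powR_gt0.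
  have sE : s = Q * G by [].
  have tE : t = m * Q * (v * rho / X).
    rewrite /t /Q.
    have -> : powR v (- b) = powR v (- b - 1) * v.
      rewrite -[X in _ = _ * X]powRr1 ?ltW// -powR_add//.
      by congr powR; ring.
    have -> : powR X m = powR X (m - 1) * X.
      rewrite -[X in _ = _ * X]powRr1 ?ltW// -powR_add//.
      by congr powR; ring.
    by field; rewrite gt_eqF.
  rewrite -(ler_pM2l (mulr_gt0 e0 (exprn_gt0 2 Q0))).
  have -> : e * Q ^+ 2 * G ^+ 2 = e * s ^+ 2 by rewrite sE; ring.
  suff -> : e * Q ^+ 2 * (C * m ^+ 2 / e * (v * rho / X) ^+ 2) = C * t ^+ 2 by exact: ltW.
  by rewrite tE; field; rewrite !gt_eqF.
have vX0 : 0 <= v * rho / X by rewrite divr_ge0 ?mulr_ge0// ltW.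
have GP : powR G (p - 2) <=
    powR (C * m ^+ 2 / e) ((p - 2) / 2) * powR (v * rho / X) (p - 2).
  have -> : powR G (p - 2) = powR (G ^+ 2) ((p - 2) / 2).
    by rewrite -powR_mulrn// -powRrM; congr powR; field.
  have -> : powR (v * rho / X) (p - 2) = powR ((v * rho / X) ^+ 2) ((p - 2) / 2).
    by rewrite -powR_mulrn// -powRrM; congr powR; field.
  rewrite -powRM ?sqr_ge0//; apply: ge0_ler_powR => //.
  - by rewrite divr_ge0// subr_ge0 ltW.
  - by rewrite nnegrE sqr_ge0.
  - by rewrite nnegrE mulr_ge0 ?sqr_ge0.
apply: (@le_trans _ _ (powR G (p - 2) * (C * t ^+ 2))).
  rewrite ler_wpM2l ?powR_ge0// gerDr mulNr oppr_le0.
  by rewrite mulr_ge0 ?sqr_ge0 ?ltW.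
apply: le_trans (ler_wpM2r _ GP) _; first by rewrite mulr_ge0 ?sqr_ge0.
rewrite le_eqVlt; apply/orP; left; apply/eqP.
have vr0 : 0 <= v * rho by rewrite mulr_ge0 ?ltW.
have Xi : 0 <= X^-1 by rewrite invr_ge0 ltW.
rewrite (powRM _ vr0 Xi) (powRM _ (ltW v0) (ltW rho0)).
have -> : powR X^-1 (p - 2) = powR X (- (p - 2)) by rewrite -powR_inv1 ?ltW// -powRrM mulN1r.
have -> : powR rho p = powR rho (p - 2) * rho ^+ 2.
  rewrite -powR_mulrn ?ltW// -powR_add//.
  by congr powR; ring.
have -> : powR v (p - 2 - 2 * b) = powR v (p - 2) * powR v (- b) ^+ 2.
  rewrite -powR_mulrn ?powR_ge0// -powRrM -powR_add//.
  by congr powR; ring.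
have -> : powR X (2 * m - p) = powR X (- (p - 2)) * powR X (m - 1) ^+ 2.
  rewrite -powR_mulrn ?powR_ge0// -powRrM -powR_add//.
  by congr powR; ring.
rewrite /t; ring.
Qed.

(* A case split replacing Young's inequality with exponents 1/theta + 1 and 1 + theta. *)
Lemma young_weight (p c C1 A theta E X M : R) :
  0 < c -> 0 <= C1 -> 0 <= A -> 0 <= theta -> 0 < E -> 0 < X -> X <= 1 ->
  p * (1 + theta) <= M ->
  C1 * A * powR E theta * powR X (M - p) - c * (powR E theta * E) * powR X M <=
  C1 * powR (C1 / c) theta * powR A (1 + theta).
Proof.
move=> c0 C10 A0 th0 E0 X0 X1 pM.
have XM : powR X M = powR X (M - p) * powR X p.
  rewrite -powR_add//.
  by congr powR; ring.
have rhs0 : 0 <= C1 * powR (C1 / c) theta * powR A (1 + theta).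
  by rewrite !mulr_ge0 ?powR_ge0.
have -> : C1 * A * powR E theta * powR X (M - p) - c * (powR E theta * E) * powR X M =
   powR E theta * powR X (M - p) * (C1 * A - c * E * powR X p) by rewrite XM; ring.
have [h|h] := leP (C1 * A) (c * E * powR X p).
  by apply: le_trans rhs0; rewrite mulr_ge0_le0 ?subr_le0// mulr_ge0 ?powR_ge0.
have Xp0 : 0 < powR X p by exact: powR_gt0.
have EA : E <= C1 / c * A * powR X (- p).
  rewrite powRN ler_pdivlMr// mulrAC ler_pdivlMr//.
  by rewrite mulrAC [E * c]mulrC ltW.
have C1c : 0 <= C1 / c by rewrite divr_ge0// ltW.
have EP : powR E theta <= powR (C1 / c) theta * powR A theta * powR X (- p * theta).
  have CA : 0 <= C1 / c * A by exact: mulr_ge0.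
  rewrite powRrM -(powRM _ C1c A0) -(powRM _ CA (powR_ge0 _ _)).
  by apply: ge0_ler_powR => //; rewrite nnegrE ?(mulr_ge0 CA) ?powR_ge0// ltW.
apply: (@le_trans _ _ (powR E theta * powR X (M - p) * (C1 * A))).
  by rewrite ler_wpM2l ?mulr_ge0 ?powR_ge0// gerDl oppr_le0 !mulr_ge0 ?powR_ge0// ltW.
rewrite -mulrA; apply: le_trans (ler_wpM2r _ EP) _.
  by rewrite !mulr_ge0 ?powR_ge0.
have -> : powR A (1 + theta) = A * powR A theta.
  have [->|An] := eqVneq A 0; last by rewrite powRD ?powRr1// An implybT.
  by rewrite powR0 ?mul0r// gt_eqF// ltr_wpDr.
have -> : powR (C1 / c) theta * powR A theta * powR X (- p * theta) *
    (powR X (M - p) * (C1 * A)) =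
    C1 * powR (C1 / c) theta * (A * powR A theta) * (powR X (- p * theta) * powR X (M - p)).
  ring.
(* The surviving power of X is M - p(1 + theta) >= 0, so it is at most 1 because X <= 1. *)
rewrite -[leRHS]mulr1 ler_wpM2l ?mulr_ge0 ?powR_ge0//.
rewrite -powR_add//.
rewrite -(powRr0 X); apply: ger_powR; first by rewrite X0.
by move: pM; rewrite mulrDr mulr1 mulNr; lra.
Qed.

End Pointwise.

(** * Arithmetic of the exponents and the combined pointwise inequality *)

Section Exponents.
Variables (R : realType) (p delta : R).
Hypotheses (p2 : 2 < p) (delta1 : 1 <= delta) (deltap : (p - 1) ^+ 2 / 4 <= delta).

Definition bexp : R := 2 * delta / (p - 1) - 1 / 2.
Definition aexp : R := 4 * delta / (p - 1).

Let q0 : 0 < p - 1. Proof. by move: p2; lra. Qed.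

(** After clearing denominators this is [deltap]; it makes theta = k - 1 nonnegative, as
    [young_weight] requires. *)
Lemma ell_ge0 : 0 <= ell p delta.
Proof.
rewrite /ell subr_ge0 ler_pdivlMr//; move: deltap; rewrite ler_pdivrMr// => h.
by rewrite mulrAC ler_pdivrMr// -expr2 (le_trans h)//; lra.
Qed.

Lemma bexp_ge0 : 0 <= bexp.
Proof. by have := ell_ge0; rewrite /ell /bexp; move: p2; lra. Qed.

Lemma aexpE : aexp = 2 * bexp + 1.
Proof. by rewrite /aexp /bexp; field; rewrite gt_eqF. Qed.

Lemma aexp_gt0 : 0 < aexp.
Proof. by rewrite aexpE; have := bexp_ge0; lra. Qed.

Lemma bexp_ell : p - 2 - 2 * bexp = - (2 * ell p delta).
Proof. by rewrite /ell /bexp; field; rewrite gt_eqF. Qed.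

Lemma kexpE : kexp p delta = 1 + 2 * ell p delta / (delta + p - 1).
Proof. by rewrite /kexp mulrDl divff// gt_eqF//; move: p2 delta1; lra. Qed.

Lemma kexp_gt0 : 0 < kexp p delta.
Proof.
rewrite kexpE ltr_pwDl// divr_ge0 ?mulr_ge0 ?ell_ge0//; move: p2 delta1; lra.
Qed.

(** The difference is exactly 2 delta - (p-1)/4. With q = p-1, (q-4)^2 >= 0 gives 8q <= q^2 + 16 <=
    20 delta by the two lower bounds on delta, which is more than enough. *)
Lemma bexp_aexp : (p - 1) * bexp ^+ 2 < delta * aexp.
Proof.
rewrite -subr_gt0.
have -> : delta * aexp - (p - 1) * bexp ^+ 2 = 2 * delta - (p - 1) / 4.
  by rewrite /aexp /bexp; field; rewrite gt_eqF.
have : 0 <= (p - 1 - 4) ^+ 2 by exact: sqr_ge0.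
by move: deltap; rewrite ler_pdivrMr//; move: delta1; nra.
Qed.

(** The constants precede the point data and rho, so the bound is uniform in the point and in the
    radius. The bound on g is asked only where X > 0, since the gradient of the quadratic bump grows
    outside the ball. The condition on k lets the cutoff power 2(k+2) survive the loss of p(1 +
    theta) powers of X. *)
Lemma pointwise_bound (k : nat) : p * kexp p delta <= 2 * k.+2%:R ->
  exists lam c C : R, [/\ 0 <= lam, 0 < c, 0 <= C &
  forall n (U g : 'rV[R]_n) (W v X rho : R),
    0 < W -> 0 < v -> 0 <= X -> X <= 1 -> 0 < rho -> (0 < X -> enorm g <= rho) ->
    let V := (- bexp * powR v (- bexp - 1) * X ^+ k.+2) *: U +
             (powR v (- bexp) * (k.+2%:R * X ^+ k.+1)) *: g in
    let E := (- aexp * powR v (- aexp - 1) * X ^+ k.*2.+4) *: U +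
             (powR v (- aexp) * (k.*2.+4%:R * X ^+ k.*2.+3)) *: g in
    is_true (W * powR (enorm U) (p - 2) * enorm V ^+ 2
    + (p - 2) * (W * powR (enorm U) (p - 4) * edot U V ^+ 2)
    - delta * powR v (- delta - 1) * (powR v (- bexp) * X ^+ k.+2) ^+ 2
    + lam * (W * powR (enorm U) (p - 2) * edot U E
             - - powR v (- delta) * (powR v (- aexp) * X ^+ k.*2.+4))
    + c * (powR v (- delta - aexp) * X ^+ k.*2.+4) <=
    if 0 < X then C * powR rho (p * kexp p delta) * powR W (kexp p delta) else 0)].
Proof.
move=> pk.
have a0 := aexp_gt0; have b0 := bexp_ge0; have ab := bexp_aexp.
have l0 := ell_ge0; have [d1 pgt2] := (delta1, p2).
(* The midpoint between (p-1) b^2 / a and delta, an interval that is nonempty by [bexp_aexp]; the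
   lower end yields K > 0 and the upper end c > 0. *)
pose lam := ((p - 1) * bexp ^+ 2 / aexp + delta) / 2.
have lamd : lam < delta.
  have : (p - 1) * bexp ^+ 2 / aexp < delta by rewrite ltr_pdivrMr.
  by rewrite /lam; lra.
have lam0 : 0 <= lam.
  have : 0 <= (p - 1) * bexp ^+ 2 / aexp.
    by apply: divr_ge0; [apply: mulr_ge0; [exact: ltW|exact: sqr_ge0]|exact: ltW].
  by rewrite /lam; lra.
pose K := lam * aexp - (p - 1) * bexp ^+ 2.
have K0 : 0 < K.
  rewrite /K /lam subr_gt0.
  have -> : ((p - 1) * bexp ^+ 2 / aexp + delta) / 2 * aexp =
      ((p - 1) * bexp ^+ 2 + delta * aexp) / 2 by field; rewrite gt_eqF.
  by lra.
(* B is the coefficient of s t in the quadratic form; C0 adds its coefficient p-1 of t^2 to the cost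
   of absorbing the cross term. *)
pose B := 2 * (p - 1) * bexp + 2 * lam.
pose C0 := B ^+ 2 / (2 * K) + (p - 1).
have C00 : 0 <= C0 by rewrite addr_ge0 ?divr_ge0 ?sqr_ge0 ?mulr_ge0// ltW.
pose m : R := k.+2%:R.
have e0 : 0 < K / 2 by rewrite divr_gt0.
pose C1 := C0 * m ^+ 2 * powR (C0 * m ^+ 2 / (K / 2)) ((p - 2) / 2).
have C10 : 0 <= C1 by rewrite !mulr_ge0 ?powR_ge0 ?sqr_ge0.
(* Only half of the surplus delta - lam is claimed in the conclusion; the other half pays for
   [young_weight]. *)
pose c := (delta - lam) / 2.
have c0 : 0 < c by rewrite /c; lra.
pose D := delta + p - 1.
have D0 : 0 < D by rewrite /D; move: p2 delta1; lra.
pose theta := 2 * ell p delta / D.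
have th0 : 0 <= theta by rewrite divr_ge0 ?mulr_ge0// ltW.
exists lam, c, (C1 * powR (C1 / c) theta); split=> //.
  by rewrite mulr_ge0 ?powR_ge0.
move=> n U g W v X rho W0 v0 X0 X1 rho0 grho V E.
(* With m = k+2, the exponents k.*2.+4 and k.*2.+3 are 2m and 2m - 1. *)
have XX : X ^+ k.*2.+4 = (X ^+ k.+2) ^+ 2 by rewrite -exprM muln2 doubleS.
have XXm : X ^+ k.*2.+3 = X ^+ k.+2 * X ^+ k.+1.
  by rewrite -exprD -addnn !addSn !addnS.
have [Xgt0|] := ltP 0 X; last first.
  move=> Xle0; have XE : X = 0 by apply/eqP; rewrite eq_le Xle0 X0.
  have VE : V = 0 by rewrite /V XE !expr0n/= !mulr0 !scale0r addr0.
  have EE : E = 0 by rewrite /E XE !expr0n/= !mulr0 !scale0r addr0.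
  rewrite VE EE !edot0r enorm0 XE !expr0n/= !(mulr0, subr0, addr0, oppr0).
  by rewrite expr0n/= mulr0 subr0.
pose Z := powR v (- bexp - 1) * X ^+ k.+2.
pose Y := m * powR v (- bexp) * X ^+ k.+1.
have Z0 : 0 <= Z by rewrite mulr_ge0 ?powR_ge0 ?exprn_ge0.
have Y0 : 0 <= Y by rewrite !mulr_ge0 ?powR_ge0 ?exprn_ge0 ?ler0n.
have VE : V = - bexp * Z *: U + Y *: g.
  by rewrite /V /Z /Y; congr (_ *: _ + _ *: _); rewrite /m; ring.
(* Here a = 2b + 1 is used: it makes the coefficients of E equal to Z^2 and Z Y up to constants. *)
have EE : E = - aexp * Z ^+ 2 *: U + 2 * Z * Y *: g.
  rewrite /E /Z /Y; congr (_ *: _ + _ *: _).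
    have -> : powR v (- aexp - 1) = powR v (- bexp - 1) ^+ 2.
      by rewrite expr2 -powR_add// aexpE; congr powR; ring.
    by rewrite XX; ring.
  have -> : k.*2.+4%:R = 2 * m by rewrite /m -natrM mul2n doubleS.
  have -> : powR v (- aexp) = powR v (- bexp - 1) * powR v (- bexp).
    by rewrite -powR_add// aexpE; congr powR; ring.
  by rewrite XXm; ring.
have := grad_energy_le _ _ p bexp aexp lam W Z Y U g p2 b0 lam0 (ltW W0) Z0 Y0.
rewrite -VE -EE /=; set s := Z * _; set t := Y * _ => en.
set t' := Y * rho.
have G0 := enorm_ge0 _ _ U.
have s0 : 0 <= s by rewrite mulr_ge0.
have t0 : 0 <= t by rewrite mulr_ge0 ?enorm_ge0.
have tt : t <= t' by rewrite ler_wpM2l// grho.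
have quad : (p - 1) * (bexp * s + t) ^+ 2 - lam * aexp * s ^+ 2 + 2 * lam * s * t <=
    - (K / 2) * s ^+ 2 + C0 * t' ^+ 2.
  have := quad_absorb _ B K s t K0.
  have : C0 * t ^+ 2 <= C0 * t' ^+ 2 by rewrite ler_wpM2l// ler_sqr ?nnegrE// (le_trans t0).
  have -> : (p - 1) * (bexp * s + t) ^+ 2 - lam * aexp * s ^+ 2 + 2 * lam * s * t =
      B * s * t - K * s ^+ 2 + (p - 1) * t ^+ 2 by rewrite /B /K; ring.
  have -> : C0 * t ^+ 2 = B ^+ 2 / (2 * K) * t ^+ 2 + (p - 1) * t ^+ 2.
    by rewrite /C0 mulrDl.
  lra.
have Vd : powR v (- delta - aexp) * X ^+ k.*2.+4 =
    powR v (- delta - 1) * (powR v (- bexp) * X ^+ k.+2) ^+ 2.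
  have -> : powR v (- delta - aexp) = powR v (- delta - 1) * (powR v (- bexp) * powR v (- bexp)).
    by rewrite -!powR_add// aexpE; congr powR; ring.
  by rewrite XX; ring.
have Vd' : powR v (- delta - aexp) * X ^+ k.*2.+4 =
    powR v (- delta) * (powR v (- aexp) * X ^+ k.*2.+4).
  by rewrite mulrA -powR_add.
pose H := powR v (- delta - aexp) * X ^+ k.*2.+4.
have m0 : 0 <= m by rewrite ler0n.
have yg := young_gradient _ p (K / 2) C0 m _ v X rho bexp p2 e0 C00 m0 G0 v0 Xgt0 rho0.
have Xm : powR X m = X ^+ k.+2 by rewrite powR_mulrn// ltW.
have Xm1 : powR X (m - 1) = X ^+ k.+1.
  by rewrite -powR_mulrn ?ltW//; congr powR; rewrite /m -natr1 addrK.
have X2m : powR X (2 * m) = X ^+ k.*2.+4.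
  by rewrite -powR_mulrn ?ltW//; congr powR; rewrite /m -natrM mul2n doubleS.
rewrite Xm Xm1 -/Z -/Y -/s -/t' in yg.
pose A := W * powR rho p.
have A0 : 0 <= A by rewrite mulr_ge0 ?powR_ge0// ltW.
pose Ev := powR v (- D).
have Ev0 : 0 < Ev by exact: powR_gt0.
have pk' : p * (1 + theta) <= 2 * m by rewrite -kexpE.
have yw := young_weight _ p c C1 A theta Ev X (2 * m) c0 C10 A0 th0 Ev0 Xgt0 X1 pk'.
have Eth : powR Ev theta = powR v (p - 2 - 2 * bexp).
  by rewrite /Ev -powRrM bexp_ell; congr powR; rewrite /theta; field; rewrite gt_eqF.
have EthE : powR Ev theta * Ev = powR v (- delta - aexp).
  by rewrite Eth /Ev -powR_add// aexpE; congr powR; rewrite /D; ring.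
rewrite EthE X2m Eth -[c * _ * _]mulrA -/H in yw.
have Ak : powR A (1 + theta) = powR rho (p * kexp p delta) * powR W (kexp p delta).
  by rewrite -kexpE /A powRM ?powR_ge0 ?(ltW W0)// -powRrM mulrC.
rewrite Ak mulrA in yw.
apply: le_trans yw.
have P0 : 0 <= W * powR (enorm U) (p - 2) by rewrite mulr_ge0 ?powR_ge0// ltW.
have en2 := le_trans en (ler_wpM2l P0 quad).
rewrite -[leRHS]mulrA in en2.
have en3 := le_trans en2 (ler_wpM2l (ltW W0) yg).
rewrite -[delta * _ * _]mulrA -Vd -/H mulNr -Vd' -/H opprK.
move: en3; rewrite -/C1.
have -> : W * (C1 * (powR rho p * powR v (p - 2 - 2 * bexp) * powR X (2 * m - p))) =
    C1 * A * powR v (p - 2 - 2 * bexp) * powR X (2 * m - p) by rewrite /A; ring.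
move: (C1 * A * _ * _) => T; rewrite /c; lra.
Qed.

End Exponents.

(** * Energy estimate *)

Section TestFunction.
Variables (R : realType) (n : nat) (u : 'rV[R]_n -> R).
Hypotheses (u0 : forall x, 0 < u x) (Cu : C1 u).

Definition cutoff (r : R) (x : 'rV[R]_n) : R := Num.max 0 (quadbump R n r x).

Definition testfun (s r : R) (m : nat) (x : 'rV[R]_n) : R :=
  powR (u x) s * cutoff r x ^+ m.+2.

Lemma cts_cutoff r : continuous (cutoff r).
Proof. by apply: cts_max0; apply: C1_cts; exact: C1_quadbump. Qed.

Lemma cutoff_ge0 r x : 0 <= cutoff r x.
Proof. by rewrite le_max lexx. Qed.

Lemma cutoff_le1 r x : 0 < r -> cutoff r x <= 1.
Proof.
move=> r0; rewrite ge_max ler01/= /quadbump gerBl divr_ge0 ?edot_ge0//.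
by rewrite exprn_ge0// ltW.
Qed.

Lemma cutoff_gt0 r x : 0 < r -> (0 < cutoff r x) = (enorm x < r).
Proof.
move=> r0; rewrite lt_max ltxx/= /quadbump subr_gt0 ltr_pdivrMr ?exprn_gt0// mul1r.
by rewrite -enorm_sqr ltr_sqr ?nnegrE ?enorm_ge0 ?ltW.
Qed.

Lemma cutoff_out r x : 0 < r -> r < enorm x -> cutoff r x = 0.
Proof.
move=> r0 rx; apply/eqP; rewrite eq_le cutoff_ge0 andbT leNgt cutoff_gt0//.
by rewrite -leNgt ltW.
Qed.

Lemma cutoff_mono r r' x : 0 < r -> r <= r' -> cutoff r x <= cutoff r' x.
Proof.
move=> r0 rr'; have r'0 := lt_le_trans r0 rr'.
rewrite ge_max cutoff_ge0/= le_max; apply/orP; right.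
rewrite /quadbump lerD2l lerN2 ler_wpM2l ?edot_ge0//.
by rewrite lef_pV2 ?posrE ?exprn_gt0// lerXn2r// nnegrE ltW.
Qed.

Lemma cutoff0 r : cutoff r 0 = 1.
Proof. by rewrite /cutoff /quadbump edot0l mul0r subr0 max_r. Qed.

Lemma grad_quadbump_le r x : 0 < r -> 0 < cutoff r x ->
  enorm (grad (quadbump R n r) x) <= 2 / r.
Proof.
move=> r0; rewrite cutoff_gt0// grad_quadbump => xr.
rewrite /enorm edotZl edotZr mulrA -expr2 sqrtrM ?sqr_ge0// sqrtr_sqr -/(enorm x).
rewrite mulNr normrN ger0_norm; last by rewrite divr_ge0// exprn_ge0// ltW.
have -> : 2 / r = 2 / r ^+ 2 * r by field; rewrite gt_eqF.
by rewrite ler_wpM2l ?ltW// divr_gt0// exprn_gt0.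
Qed.

Let dpow s x : is_derive (u x) 1 (fun t => powR t s) (s * powR (u x) (s - 1)).
Proof. exact: is_derive1_powR. Qed.

Let cpow s : C1 (fun x => powR (u x) s).
Proof.
apply: (@C1_Rcomp R n u (fun t => powR t s) (fun t => s * powR t (s - 1))) => //.
apply: ctsM; first exact: cts_cst.
by apply: cts_powR => //; exact: C1_cts.
Qed.

Let ccut r m : C1 (fun x => cutoff r x ^+ m.+2).
Proof.
apply: (@C1_Rcomp R n (quadbump R n r) (fun t => Num.max 0 t ^+ m.+2)
  (fun t => m.+2%:R * Num.max 0 t ^+ m.+1)).
- exact: C1_quadbump.
- by move=> x; exact: is_derive_posX.
- by apply: ctsM; [exact: cts_cst|apply: ctsX; exact: cts_cutoff].
Qed.

Lemma C1_testfun s r m : C1 (testfun s r m).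
Proof. exact: (C1_mul _ _ _ _ (cpow s) (ccut r m)). Qed.

Lemma grad_testfun s r m x : grad (testfun s r m) x =
  (s * powR (u x) (s - 1) * cutoff r x ^+ m.+2) *: grad u x +
  (powR (u x) s * (m.+2%:R * cutoff r x ^+ m.+1)) *: grad (quadbump R n r) x.
Proof.
rewrite (grad_mul _ _ (fun y => powR (u y) s)); last 2 first.
- exact: (cpow s).1.
- exact: (ccut r m).1.
rewrite (grad_Rcomp _ _ u (fun t => powR t s) _ x (Cu.1 x) (dpow s x)).
rewrite (grad_Rcomp _ _ (quadbump R n r) _ _ x (differentiable_quadbump _ _ r x)
  (is_derive_posX _ m (quadbump R n r x))).
by rewrite !scalerA addrC -/(cutoff r x) [cutoff r x ^+ _ * _]mulrC.
Qed.

Lemma testfun_out s r m x : 0 < r -> r < enorm x -> testfun s r m x = 0.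
Proof. by move=> r0 rx; rewrite /testfun cutoff_out// expr0n mulr0. Qed.

Lemma grad_testfun_out s r m x : 0 < r -> r < enorm x -> grad (testfun s r m) x = 0.
Proof.
move=> r0 rx; rewrite grad_testfun cutoff_out// !expr0n/= !mulr0.
by rewrite !scale0r addr0.
Qed.

Lemma C1c_testfun s r m : 0 < r -> C1c (testfun s r m).
Proof.
by move=> r0; split; [exact: C1_testfun|exists r => x; exact: testfun_out].
Qed.

End TestFunction.

Lemma has_csupp_enorm (R : realType) n (f : 'rV[R]_n -> R) r :
  continuous f -> (forall x, r < enorm x -> f x = 0) -> has_csupp R n f.
Proof.
move=> cf f0; split=> //; exists r => x rx; apply: f0.
exact: lt_le_trans rx (norm_le_enorm _ _ _).
Qed.

(* Where U vanishes, powR 0 (p - 4) is 0 or 1 by convention and edot (U x) (V x) is 0,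
   so continuity there comes from the Cauchy-Schwarz bound alone. *)
Lemma cts_powR_edot (R : realType) (T : topologicalType) n (U V : T -> 'rV[R]_n) (p : R) :
  2 < p ->
  continuous U -> continuous V ->
  continuous (fun x => powR (enorm (U x)) (p - 4) * edot (U x) (V x) ^+ 2).
Proof.
move=> p2 cU cV.
have p20 : 0 < p - 2 by lra.
have cbd : continuous (fun x => powR (enorm (U x)) (p - 2) * enorm (V x) ^+ 2).
  apply: ctsM; last by apply: ctsX; exact: cts_enorm.
  by apply: cts_powR_ge0 => // [x|]; [exact: enorm_ge0|exact: cts_enorm].
have bd x : powR (enorm (U x)) (p - 4) * edot (U x) (V x) ^+ 2 <=
    powR (enorm (U x)) (p - 2) * enorm (V x) ^+ 2.
  exact: powR_edot_le.
have ce : continuous (fun x => edot (U x) (V x) ^+ 2).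
  by apply: ctsX; exact: cts_edot.
move=> x; have [Ux|Ux] := eqVneq (enorm (U x)) 0; last first.
  apply: cvgM; last exact: ce.
  apply: (@continuous_comp T R R (fun y => enorm (U y)) (fun t => powR t (p - 4)) x).
    exact: cts_enorm.
  apply: differentiable_continuous; apply/derivable1_diffP.
  by apply: derivable_powR; rewrite in_itv/= andbT lt_def Ux enorm_ge0.
apply/cvgrPdist_lt => e e0; rewrite (enorm_eq0 _ _ _ Ux) edot0l expr0n mulr0.
have /cvgrPdist_lt/(_ _ e0) := cbd x.
apply: filterS => y; rewrite Ux powR0 ?gt_eqF// mul0r !sub0r !normrN => h.
have E0 : 0 <= powR (enorm (U y)) (p - 4) * edot (U y) (V y) ^+ 2.
  by apply: mulr_ge0; [exact: powR_ge0|exact: sqr_ge0].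
rewrite (ger0_norm E0); apply: le_lt_trans (bd y) _.
exact: le_lt_trans (ler_norm _) h.
Qed.

Section Energy.
Variables (R : realType) (n : nat) (p delta : R) (w u : 'rV[R]_n -> R).
Hypotheses (p2 : 2 < p) (delta1 : 1 <= delta) (deltap : (p - 1) ^+ 2 / 4 <= delta).
Hypotheses (Cw : C1 w) (w0 : forall x, 0 < w x).
Hypotheses (u0 : forall x, 0 < u x) (Cu : C1 u).
Hypotheses (usol : weak_solution p delta w u) (ustable : stable p delta w u).

Local Notation b := (bexp R p delta).
Local Notation a := (aexp R p delta).

(** The cutoff of radius r lives in the ball of [QR] at r / 2, since [QR] integrates over the
    doubled radius. The support statement is exported so that the integrals for two radii can be
    compared later. *)
Lemma energy_estimate (k : nat) : p * kexp p delta <= 2 * k.+2%:R ->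
  exists c C : R, [/\ 0 < c, 0 < C & forall r : R, 0 < r ->
    has_csupp R n (fun x => powR (u x) (- delta - a) * cutoff R n r x ^+ k.*2.+4) /\
    ((c * iintR (fun x => powR (u x) (- delta - a) * cutoff R n r x ^+ k.*2.+4))%:E <=
     (C * powR (2 / r) (p * kexp p delta))%:E * QR p delta w (r / 2))%E].
Proof.
move=> pk.
have [lam [c [C [lam0 c0 C0 pw]]]] := pointwise_bound R p delta p2 delta1 deltap k pk.
(* C is only nonnegative; adding 1 makes the factor K below positive, so that it can be divided
   out. *)
exists c, (C + 1); split=> //; first by rewrite ltr_wpDl.
move=> r r0.
have cw := C1_cts _ _ _ Cw; have cu := C1_cts _ _ _ Cu; have cgu := Cu.2.
pose phi := testfun R n u (- b) r k.
(* [testfun] raises the cutoff to its index plus 2, so this is X^(2k+4), the square of the power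
   X^(k+2) in [phi]. *)
pose eta := testfun R n u (- a) r k.*2.+2.
have Cphi : C1 phi by exact: C1_testfun.
have Ceta : C1 eta by exact: C1_testfun.
have cphi := C1_cts _ _ _ Cphi; have ceta := C1_cts _ _ _ Ceta.
have phi_out x : r < enorm x -> phi x = 0 by exact: testfun_out.
have eta_out x : r < enorm x -> eta x = 0 by exact: testfun_out.
have gphi_out x : r < enorm x -> grad phi x = 0 by exact: grad_testfun_out.
have geta_out x : r < enorm x -> grad eta x = 0 by exact: grad_testfun_out.
pose G x := powR (enorm (grad u x)) (p - 2).
have cG : continuous G.
  by apply: cts_powR_ge0 => [|x|]; [|exact: enorm_ge0|exact: cts_enorm]; move: p2; lra.
pose S1 x := w x * powR (enorm (grad u x)) (p - 2) * enorm (grad phi x) ^+ 2.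
pose S2 x := w x * powR (enorm (grad u x)) (p - 4) * edot (grad u x) (grad phi x) ^+ 2.
pose S3 x := delta * powR (u x) (- delta - 1) * phi x ^+ 2.
pose W1 x := w x * powR (enorm (grad u x)) (p - 2) * edot (grad u x) (grad eta x).
pose W2 x := - powR (u x) (- delta) * eta x.
pose V x := powR (u x) (- delta - a) * cutoff R n r x ^+ k.*2.+4.
have hS1 : has_csupp R n S1.
  apply: (has_csupp_enorm _ _ _ r) => [|x rx]; last by rewrite /S1 gphi_out// enorm0 expr0n mulr0.
  by apply: ctsM; [exact: ctsM|apply: ctsX; apply: cts_enorm; exact: Cphi.2].
have hS2 : has_csupp R n S2.
  apply: (has_csupp_enorm _ _ _ r) => [|x rx]; last by rewrite /S2 gphi_out// edot0r expr0n mulr0.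
  rewrite /S2; under eq_fun do rewrite -mulrA.
  apply: ctsM; first exact: cw.
  by apply: cts_powR_edot; [exact: p2|exact: cgu|exact: Cphi.2].
have hS3 : has_csupp R n S3.
  apply: (has_csupp_enorm _ _ _ r) => [|x rx]; last by rewrite /S3 phi_out// expr0n mulr0.
  apply: ctsM; last exact: ctsX.
  by apply: ctsM; [exact: cts_cst|exact: cts_powR].
have hW1 : has_csupp R n W1.
  apply: (has_csupp_enorm _ _ _ r) => [|x rx]; last by rewrite /W1 geta_out// edot0r mulr0.
  by apply: ctsM; [exact: ctsM|apply: cts_edot; [exact: cgu|exact: Ceta.2]].
have hW2 : has_csupp R n W2.
  apply: (has_csupp_enorm _ _ _ r) => [|x rx]; last by rewrite /W2 eta_out// mulr0.
  by apply: ctsM; [apply: ctsN; exact: cts_powR|exact: ceta].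
have hV : has_csupp R n V.
  apply: (has_csupp_enorm _ _ _ r) => [|x rx]; last by rewrite /V cutoff_out// expr0n mulr0.
  by apply: ctsM; [exact: cts_powR|apply: ctsX; exact: cts_cutoff].
split=> //.
have h0 : has_csupp R n (fun=> 0) by split; [exact: cts_cst|exists 0].
(* The sums are nested in the shape [a * f + g] so that [iintR_lin] peels off one term at a time;
   the integral of F1 is the stability form, plus lam times zero, plus c times that of V. *)
pose F0 x := (- lam) * W2 x + (c * V x + 0).
pose F1 x := 1 * S1 x + ((p - 2) * S2 x + (-1 * S3 x + (lam * W1 x + F0 x))).
have hF0 : has_csupp R n F0 by do 2 (apply: has_csupp_lin => //).
have hF1 : has_csupp R n F1 by do 4 (apply: has_csupp_lin => //).
have iF1 : c * iintR V <= iintR F1.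
  rewrite /F1 iintR_lin//; last by do 3 (apply: has_csupp_lin => //).
  rewrite iintR_lin//; last by do 2 (apply: has_csupp_lin => //).
  rewrite iintR_lin//; last by apply: has_csupp_lin.
  rewrite iintR_lin// /F0 iintR_lin//; last by apply: has_csupp_lin.
  rewrite iintR_lin// iintR0.
  have /eqP := usol eta (C1c_testfun R n u u0 Cu (- a) r k.*2.+2 r0).
  have := ustable phi (C1c_testfun R n u u0 Cu (- b) r k r0).
  rewrite -/S1 -/S2 -/S3 subr_eq0 => st /eqP ws.
  have -> : iintR W1 = iintR W2 by exact: ws.
  by move: st; rewrite /S1 /S2 /S3; lra.
pose K := (C + 1) * powR (2 / r) (p * kexp p delta).
have K0 : 0 < K by rewrite mulr_gt0 ?ltr_wpDl// powR_gt0// divr_gt0.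
have F1pw x : F1 x <= if 0 < cutoff R n r x then K * powR (w x) (kexp p delta) else 0.
  have rho0 : 0 < 2 / r by rewrite divr_gt0.
  have := pw n (grad u x) (grad (quadbump R n r) x) (w x) (u x) (cutoff R n r x) (2 / r)
    (w0 x) (u0 x) (cutoff_ge0 _ _ _ _) (cutoff_le1 _ _ _ x r0) rho0
    (grad_quadbump_le _ _ _ x r0).
  rewrite -(grad_testfun R n u u0 Cu (- b) r k x) -(grad_testfun R n u u0 Cu (- a) r k.*2.+2 x) /= => H.
  apply: le_trans (le_trans _ H) _.
    rewrite le_eqVlt; apply/orP; left; apply/eqP.
    rewrite /F1 /F0 /S1 /S2 /S3 /W1 /W2 /V /phi /eta /testfun; ring.
  case: ifP => // _; rewrite ler_wpM2r ?powR_ge0// ler_wpM2r ?powR_ge0//.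
  by rewrite lerDl.
(* F1 may be negative, while the passage to [iintE] needs a nonnegative continuous function: the
   normalised positive part lies below the truncated w^k itself. *)
pose Fp x := Num.max 0 (K^-1 * F1 x).
have hFp : has_csupp R n Fp.
  have [cF1 [s F10]] := hF1; split; last by exists s => x /F10 h; rewrite /Fp h mulr0 maxxx.
  by apply: cts_max0; apply: ctsM => //; exact: cts_cst.
have FK : iintR F1 <= K * iintR Fp.
  rewrite -[leRHS]addr0 -(iintR0 R n) -iintR_lin//; apply: iintR_le => //.
    exact: has_csupp_lin.
  by move=> x; rewrite addr0 -ler_pdivrMl// /Fp le_max lexx orbT.
have FQ : ((iintR Fp)%:E <= QR p delta w (r / 2))%E.
  apply: iintR_le_iintE => // x; first by rewrite /Fp le_max lexx.
  have -> : 2 * (r / 2) = r by field.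
  rewrite -cutoff_gt0//; have := F1pw x.
  case: ifP => _ h; rewrite lee_fin /Fp ge_max ?lexx ?powR_ge0/= ler_pdivrMl// ?mulr0//.
rewrite (le_trans (_ : _ <= (K * iintR Fp)%:E)%E)//; first by rewrite lee_fin (le_trans iF1).
by rewrite EFinM lee_pmul2l// lte_fin.
Qed.

End Energy.

(** * Choice of the radius and conclusion *)

Lemma exists_large_powR (R : realType) (e M sigma R0 : R) :
  0 < e -> 0 < sigma -> exists s : R, [/\ 1 <= s, R0 <= s & M * powR s (- sigma) < e].
Proof.
move=> e0 sg0; set t := powR (`|M| / e) sigma^-1.
have t0 : 0 <= t by exact: powR_ge0.
exists (Num.max 1 (Num.max R0 (t + 1))); set s := Num.max _ _.
have s1 : 1 <= s by rewrite le_max lexx.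
have sR : R0 <= s by rewrite !le_max lexx orbT.
have st : t < s by rewrite !lt_max ltrDl ltr01 !orbT.
have s0 : 0 < s by lra.
split=> //; apply: le_lt_trans (ler_wpM2r (powR_ge0 _ _) (ler_norm M)) _.
rewrite powRN ltr_pdivrMr ?powR_gt0// mulrC -ltr_pdivrMr//.
have -> : `|M| / e = powR t sigma.
  by rewrite /t -powRrM mulVf ?gt_eqF// powRr1// divr_ge0// ltW.
by apply: gt0_ltr_powR => //; rewrite nnegrE ltW.
Qed.

Theorem theorem3 (R : realType) (N : nat) (p delta : R) (w : 'rV[R]_N -> R) (tau : R) :
  (1 <= N)%N -> 2 < p -> 1 <= delta -> (p - 1) ^+ 2 / 4 <= delta ->
  C1 w -> (forall x, 0 < w x) -> (exists C : R, 0 < C /\ forall x, C < w x) ->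
  0 < tau -> tau < p * kexp p delta ->
  (exists C0 R0 : R, forall r : R, R0 <= r ->
      (QR p delta w r <= (C0 * powR r tau)%:E)%E) ->
  forall zeta : R, 0 < zeta -> zeta < 1 ->
  ~ exists u : 'rV[R]_N -> R,
      (forall x, 0 < u x) /\ C1zeta_loc zeta u /\
      weak_solution p delta w u /\ stable p delta w u.
Proof.
move=> _ p2 delta1 deltap Cw w0 _ _ tauk [C0 [R0 hQ]] zeta _ _.
move=> [u [u0 [[Cu _] [usol ustable]]]].
pose pk := p * kexp p delta.
have pk0 : 0 < pk by rewrite mulr_gt0 ?kexp_gt0//; lra.
(* Truncation gives pk < 2(k+1), which is below the required 2(k+2). *)
pose k := Num.truncn (pk / 2).
have pkk : pk <= 2 * k.+2%:R.
  have := truncnS_gt (pk / 2); rewrite -/k -[k.+2]addn1 natrD; lra.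
have [c [C [c0 C_gt0 en]]] := energy_estimate R N p delta w u
  p2 delta1 deltap Cw w0 u0 Cu usol ustable k pkk.
pose V r x := powR (u x) (- delta - aexp R p delta) * cutoff R N r x ^+ k.*2.+4.
have I1 : 0 < iintR (V 1).
  apply: iintR_gt0; first exact: (en 1 ltr01).1.
    by move=> x; rewrite mulr_ge0 ?powR_ge0// exprn_ge0// cutoff_ge0.
  by rewrite /V cutoff0 expr1n mulr1 powR_gt0.
have sg0 : 0 < pk - tau by rewrite subr_gt0.
(* The cutoff radius will be 2s, so that [QR] is evaluated at s >= R0. Since 2s >= 1, the integral
   for 2s is at least the one for radius 1, a fixed positive number that the decaying bound drops
   below. *)
have [s [s1 sR sM]] := exists_large_powR R _ (C * C0) _ R0 (mulr_gt0 c0 I1) sg0.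
have s0 : 0 < s by lra.
have r1 : 1 <= 2 * s by lra.
have r0 : 0 < 2 * s by lra.
have [hV] := en (2 * s) r0.
have -> : 2 * s / 2 = s by field.
have -> : 2 / (2 * s) = s^-1 by field; rewrite gt_eqF.
have K0 : 0 <= C * powR s^-1 pk by rewrite mulr_ge0 ?powR_ge0// ltW.
move=> /le_trans /(_ (lee_wpmul2l _ (hQ s sR))); rewrite lee_fin K0 -EFinM lee_fin => /(_ isT).
apply/negP; rewrite -ltNge.
have -> : C * powR s^-1 pk * (C0 * powR s tau) = C * C0 * powR s (- (pk - tau)).
  rewrite -powR_inv1 ?ltW// -powRrM opprB powR_add// mulN1r; ring.
apply: (lt_le_trans sM); rewrite ler_wpM2l ?(ltW c0)//.
apply: iintR_le => //; first exact: (en 1 ltr01).1.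
move=> x; rewrite ler_wpM2l ?powR_ge0// lerXn2r// ?nnegrE ?cutoff_ge0//.
exact: cutoff_mono.
Qed.
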